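(* Let $\mathcal{S}$ be a dilation invariant finite system of equations. The following are equivalent: (I) $\mathcal{S}$ is partition regular over $\mathbb{N}$; (II) $\mathcal{S}$ is partition regular over every multiplicatively thick set; (III) $\mathcal{S}$ is partition regular over every multiplicatively piecewise syndetic set; (IV) $\mathcal{S}$ is partition regular over every multiplicatively syndetic set; (V) $\mathcal{S}$ has a non-trivial solution with all entries in $P$, for every multiplicatively piecewise syndetic set $P$; (VI) $\mathcal{S}$ has a non-trivial solution with all entries in $S$, for every multiplicatively syndetic set $S$.
   Context: $\mathbb{N}=\{1,2,3,\dots\}$. A finite system of equations $\mathcal{S}$ in $s$ variables consists of finitely many equations $p_i(t_1,\dots,t_s)=0$ with $p_i\in\mathbb{Q}[t_1,\dots,t_s]$. A solution is $\mathbf{x}\in\mathbb{N}^s$ satisfying all equations; it is non-trivial if its entries are not all equal. $\mathcal{S}$ is dilation invariant if whenever $\mathbf{x}$ is a solution, $\lambda\mathbf{x}$ also satisfies all equations for every $\lambda\in\mathbb{Q}$. For $B\subseteq\mathbb{N}$, $\mathcal{S}$ is partition regular over $B$ if for every $r\in\mathbb{N}$ and every $r$-colouring of $B$ there exists a monochromatic non-trivial solution with all entries in $B$. A set $T\subseteq\mathbb{N}$ is multiplicatively thick if for every finite $E\subset\mathbb{N}$ there is $t\in\mathbb{N}$ with $\{tx:x\in E\}\subseteq T$. For non-empty finite $F\subset\mathbb{N}$: $S$ is multiplicatively $F$-syndetic if for every $n\in\mathbb{N}$ there is $t\in F$ with $nt\in S$; $S$ is multiplicatively piecewise $F$-syndetic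 if $\bigcup_{t\in F}\{n\in\mathbb{N}:nt\in S\}$ is multiplicatively thick. A set is multiplicatively (piecewise) syndetic if it is multiplicatively (piecewise) $F$-syndetic for some non-empty finite $F\subset\mathbb{N}$. *)

(* Defs.v *)
From mathcomp Require Import all_boot all_order all_algebra.
From mathcomp Require Import mpoly.
From mathcomp Require Import classical_sets cardinality.
Set Implicit Arguments.
Unset Strict Implicit.
Unset Printing Implicit Defensive.
Local Open Scope classical_set_scope.
Local Open Scope ring_scope.

(* The naturals here start at 1, whereas [nat] contains 0. Subsets of the
   naturals are represented as sets of type [set nat] contained in [Npos]. *)
Definition Npos : set nat := [set n : nat | (0 < n)%N].

(* A list [Sys] of polynomials in Q[t_1, ..., t_s] stands for the finite system
   of equations p = 0 for p in [Sys]. *)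
Definition satisfies (s : nat) (Sys : seq {mpoly rat[s]})
    (v : 'I_s -> rat) : Prop :=
  forall p, p \in Sys -> p.@[v] = 0.

Definition solution (s : nat) (Sys : seq {mpoly rat[s]})
    (x : 'I_s -> nat) : Prop :=
  (forall i, Npos (x i)) /\ satisfies Sys (fun i => (x i)%:R).

Definition nontrivial (s : nat) (x : 'I_s -> nat) : Prop :=
  ~ (forall i j, x i = x j).

Definition dilation_invariant (s : nat) (Sys : seq {mpoly rat[s]}) : Prop :=
  forall x : 'I_s -> nat, solution Sys x ->
  forall lam : rat, satisfies Sys (fun i => lam * (x i)%:R).

Definition has_nontrivial_solution_in (s : nat) (Sys : seq {mpoly rat[s]})
    (B : set nat) : Prop :=
  exists x : 'I_s -> nat,
    [/\ solution Sys x, nontrivial x & forall i, B (x i)].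

(* Since r > 0, every r-colouring of B extends to a total function [c]; only
   its values on B are used. *)
Definition partition_regular_over (s : nat) (Sys : seq {mpoly rat[s]})
    (B : set nat) : Prop :=
  forall r : nat, (0 < r)%N -> forall c : nat -> 'I_r,
  exists x : 'I_s -> nat,
    [/\ solution Sys x, nontrivial x, forall i, B (x i)
      & exists k : 'I_r, forall i, c (x i) = k].

Definition mult_thick (T : set nat) : Prop :=
  T `<=` Npos /\
  forall E : set nat, finite_set E -> E `<=` Npos ->
  exists2 t : nat, Npos t & [set (t * x)%N | x in E] `<=` T.

Definition mult_syndetic_wrt (F S : set nat) : Prop :=
  S `<=` Npos /\
  forall n : nat, Npos n -> exists2 t : nat, F t & S (n * t)%N.

Definition mult_pw_syndetic_wrt (F S : set nat) : Prop :=
  S `<=` Npos /\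
  mult_thick (\bigcup_(t in F) [set n | Npos n /\ S (n * t)%N]).

Definition mult_syndetic (S : set nat) : Prop :=
  exists F : set nat,
    [/\ F !=set0, finite_set F, F `<=` Npos & mult_syndetic_wrt F S].

Definition mult_pw_syndetic (S : set nat) : Prop :=
  exists F : set nat,
    [/\ F !=set0, finite_set F, F `<=` Npos & mult_pw_syndetic_wrt F S].

(* Main.v *)
(** Every colouring [c] of the positive integers has, among the pointwise limits
    of its dilates [n |-> c (t * n)], one with a multiplicatively syndetic colour
    class: if the class of [i] is not syndetic, then some limit of dilates of [c]
    avoids [i], and one concludes by induction on the number of colours.  A
    solution inside that class is a finite pattern, so it is carried back to a
    monochromatic solution for [c] by a dilation; this gives (VI) => (I).
    Conversely, compactness turns (I) into a statement about finite sets, which can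
    be dilated into any thick set, and a colouring of a piecewise [F]-syndetic set
    [P] induces one of the thick set [\bigcup_(t in F) [set n | P (n * t)]] by
    recording a suitable [t] together with the colour of [n * t]. *)

Require Import Defs.
From mathcomp Require Import all_boot all_order all_algebra.
From mathcomp Require Import mpoly.
From mathcomp Require Import boolp classical_sets cardinality.
Set Implicit Arguments.
Unset Strict Implicit.
Unset Printing Implicit Defensive.
Import GRing.Theory.
Local Open Scope classical_set_scope.

(** König's lemma: a word is [good] if it is a prefix of [c k] for arbitrarily large [k]. As [C] is
    finite, good words extend by one letter, and [d] is read off from the growing words. *)
Lemma colouring_cluster_point (C : finType) (c : nat -> nat -> C) :
  exists d : nat -> C, forall m K, exists2 k, K <= k &
    forall n, n < m -> c k n = d n.
Proof.
pose good w := forall K, exists2 k, K <= k & mkseq (c k) (size w) = w.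
have good_rcons w : exists a, good w -> good (rcons w a).
  apply: contrapT => /forallNP bad.
  have /not_implyP[good_w _] := bad (c 0 0).
  have /choice[K KP] : forall a, exists K, forall k, K <= k ->
      mkseq (c k) (size w).+1 <> rcons w a.
    move=> a; have /not_implyP[_ /existsNP[K noK]] := bad a.
    exists K => k leKk eqk; apply: noK; exists k => //.
    by rewrite size_rcons.
  (* Pigeonhole: past every [K a], no letter at all could follow [w]. *)
  have [k le_k eqk] := good_w (\max_a K a).
  apply: (KP (c k (size w)) k); last by rewrite mkseqS eqk.
  by apply: leq_trans le_k; apply: leq_bigmax.
have [step stepP] := choice good_rcons.
pose W := fix W n := if n is n'.+1 then rcons (W n') (step (W n')) else [::].
have goodW n : good (W n).
  by elim: n => [|n IHn] /=; [move=> K; exists K | apply: stepP].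
have WE n : W n = mkseq (fun n => step (W n)) n.
  by elim: n => //= n {1}->; rewrite mkseqS.
exists (fun n => step (W n)) => m K.
have [k leKk] := goodW m K; rewrite WE size_mkseq => eqk; exists k => // n ltnm.
by have := congr1 (fun w => nth (c 0 0) w n) eqk; rewrite !nth_mkseq.
Qed.

(** Closure of the dilates of [c] in the product topology on colourings of the positive integers;
    the value at 0 is ignored. *)
Definition dilation_limit (C : Type) (c d : nat -> C) : Prop :=
  forall m, exists2 t, 0 < t & forall n, 0 < n < m -> d n = c (t * n).

Lemma dilation_limit_refl (C : Type) (c : nat -> C) : dilation_limit c c.
Proof. by move=> m; exists 1 => // n _; rewrite mul1n. Qed.

Lemma dilation_limit_trans (C : Type) (c d e : nat -> C) :
  dilation_limit c d -> dilation_limit d e -> dilation_limit c e.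
Proof.
move=> cd de m; have [t t_gt0 tP] := de m; have [u u_gt0 uP] := cd (t * m).
exists (u * t); first by rewrite muln_gt0 u_gt0.
move=> n /andP[n_gt0 ltnm]; rewrite tP ?n_gt0 // uP ?mulnA //.
by rewrite muln_gt0 t_gt0 n_gt0 ltn_pmul2l.
Qed.

(** Failure of syndeticity for each initial segment yields multipliers [N k] whose dilates avoid [i]
    on longer and longer segments; a cluster point of these dilates avoids [i] everywhere. *)
Lemma dilation_limit_avoid (C : finType) (c : nat -> C) (i : C) :
  ~ mult_syndetic [set n | 0 < n /\ c n = i] ->
  exists2 d, dilation_limit c d & forall n, 0 < n -> d n <> i.
Proof.
move=> not_synd.
have /choice[N NP] : forall k, exists n, 0 < n /\
    forall t, 0 < t < k.+2 -> c (n * t) <> i.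
  move=> k; apply: contrapT => /forallNP noN; apply: not_synd.
  (* The bound [k.+2] keeps 1 in this set even when [k] is 0. *)
  exists [set t | 0 < t < k.+2]; split.
  - by exists 1.
  - by apply: sub_finite_set (finite_II k.+2) => t /= /andP[].
  - by move=> t /= /andP[].
  split=> [n []//|n /= n_gt0].
  apply: contrapT => noT; apply: (noN n); split=> // t tk cnt; apply: noT.
  exists t => //=; split=> //.
  by rewrite muln_gt0 n_gt0; case/andP: tk.
have [d dP] := colouring_cluster_point (fun k n => c (N k * n)).
exists d => [m|n n_gt0 dni].
  have [k _ kP] := dP m 0; exists (N k); first by have [] := NP k.
  by move=> n /andP[_ /kP].
(* Taking [k] at least [n] puts [n] in the segment where the dilate by [N k] avoids [i]. *)
have [k lenk kP] := dP n.+1 n; have [_ /(_ n)] := NP k.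
rewrite n_gt0 kP ?dni // => /(_ _)/= []//.
by rewrite ltnS ltnW.
Qed.

Lemma dilation_limit_syndetic (C : finType) (c : nat -> C) :
  exists2 d, dilation_limit c d &
    exists i, mult_syndetic [set n | 0 < n /\ d n = i].
Proof.
have: forall n, 0 < n -> c n \in [set: C]%SET by move=> n _; rewrite inE.
(* Induction on a bound [m] for the size of a set [A] containing all colours of positive
   integers. *)
move: {2}#|_| (leqnn #|[set: C]%SET|) => m; move: [set: C]%SET => A.
elim: m A c => [|m IHm] A c.
  by rewrite leqn0 cards_eq0 => /eqP-> /(_ 1 isT); rewrite inE.
move=> cardA cA; have [synd|] := pselect (mult_syndetic [set n | 0 < n /\ c n = c 1]).
  by exists c; [apply: dilation_limit_refl | exists (c 1)].
move=> /dilation_limit_avoid[d cd d_avoid].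
have [||e de ?] := IHm (A :\ c 1)%SET d; last first.
- by exists e => //; apply: dilation_limit_trans de.
- move=> n n_gt0; rewrite in_setD1; have [t t_gt0 tP] := cd n.+1.
  apply/andP; split; first by apply/eqP/d_avoid.
  by rewrite tP ?n_gt0 ?leqnn // cA // muln_gt0 t_gt0.
- by move: cardA; rewrite (cardsD1 (c 1)) cA.
Qed.

Lemma thick_Npos : mult_thick Npos.
Proof.
by split=> // E _ E_pos; exists 1 => //= _ [x Ex <-]; rewrite mul1n; apply: E_pos.
Qed.

Lemma syndetic_Npos : mult_syndetic Npos.
Proof.
exists [set 1]; split; [by exists 1 | exact: finite_set1 | by move=> _ -> |].
by split=> // n n_gt0; exists 1; rewrite ?muln1.
Qed.

Lemma syndetic_pw_syndetic (S : set nat) : mult_syndetic S -> mult_pw_syndetic S.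
Proof.
move=> [F [F0 finF F_pos [S_pos SP]]]; exists F; split=> //; split=> //.
suff -> : \bigcup_(t in F) [set n | Npos n /\ S (n * t)] = Npos.
  exact: thick_Npos.
apply/seteqP; split=> [n [t _ []//]|n n_gt0].
by have [t Ft St] := SP n n_gt0; exists t.
Qed.

Section PartitionRegularity.
Variables (s : nat) (Sys : seq {mpoly rat[s]}).

Lemma nontrivial_dilate (x : 'I_s -> nat) (t : nat) :
  0 < t -> nontrivial x -> nontrivial (fun i => t * x i).
Proof.
move=> t_gt0 ntx eqx; apply: ntx => i j.
by apply/eqP; rewrite -(eqn_pmul2l t_gt0); apply/eqP/eqx.
Qed.

(** For [s = 0] all entries are vacuously equal. *)
Lemma nontrivial_index (x : 'I_s -> nat) : nontrivial x -> inhabited 'I_s.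
Proof. by move=> ntx; apply: contrapT => no; apply: ntx => i; case: no. Qed.

Lemma partition_regular_finType (B : set nat) :
  partition_regular_over Sys B -> forall (C : finType) (c : nat -> C),
  exists x : 'I_s -> nat, [/\ solution Sys x, nontrivial x,
    forall i, B (x i) & exists k, forall i, c (x i) = k].
Proof.
move=> prB C c; have C_gt0 : 0 < #|C| by apply/card_gt0P; exists (c 0).
have [x [solx ntx Bx [k kP]]] := prB _ C_gt0 (fun n => enum_rank (c n)).
by exists x; split=> //; exists (enum_val k) => i; rewrite -(kP i) enum_rankK.
Qed.

(* The compactness principle: the solution can be found below a bound that
   depends only on the set of colours. *)
Lemma partition_regular_bounded :
  partition_regular_over Sys Npos -> forall C : finType, exists m, forall c : nat -> C,
  exists x : 'I_s -> nat, [/\ solution Sys x, nontrivial x,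
    forall i, x i < m & exists k, forall i, c (x i) = k].
Proof.
move=> pr C; apply: contrapT => /forallNP unbounded.
have /choice[c cP] := fun m => (existsNP _).2 (unbounded m).
have [d dP] := colouring_cluster_point c.
have [x [solx ntx _ [k kP]]] := partition_regular_finType pr d.
pose m := (\max_i x i).+1; have ltxm i : x i < m by rewrite ltnS leq_bigmax.
(* Since [c l] agrees with [d] below [m] and [m <= l], [x] is a solution that [c l] was chosen to
   exclude. *)
have [l lem lP] := dP m m; apply: (cP l); exists x; split=> //.
  by move=> i; apply: leq_trans lem.
by exists k => i; rewrite lP.
Qed.

Hypothesis Sys_dil : dilation_invariant Sys.

Lemma solution_dilate (x : 'I_s -> nat) (t : nat) :
  0 < t -> solution Sys x -> solution Sys (fun i => t * x i).
Proof.
move=> t_gt0 solx; split=> [i|p pS].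
  by rewrite /Npos /= muln_gt0 t_gt0; apply: solx.1.
rewrite -(Sys_dil solx t%:R%R pS); congr (_.@[_])%R.
by apply/funext => i; rewrite natrM.
Qed.

Lemma partition_regular_thick : partition_regular_over Sys Npos ->
  forall T, mult_thick T -> partition_regular_over Sys T.
Proof.
move=> pr T [T_pos thickT] r r_gt0 c.
have [m mP] := partition_regular_bounded pr 'I_r.
have [||t t_gt0 tT] := thickT [set n | 0 < n < m].
- by apply: sub_finite_set (finite_II m) => n /= /andP[].
- by move=> n /= /andP[].
have [x [solx ntx ltxm [k kP]]] := mP (fun n => c (t * n)).
exists (fun i => t * x i); split; last by exists k.
- exact: solution_dilate.
- exact: nontrivial_dilate.
- by move=> i; apply: tT; exists (x i) => //=; rewrite ltxm andbT; apply: solx.1.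
Qed.

Lemma partition_regular_pw_syndetic :
  (forall T, mult_thick T -> partition_regular_over Sys T) ->
  forall P, mult_pw_syndetic P -> partition_regular_over Sys P.
Proof.
move=> prT P [F [_ finF F_pos [P_pos thickT]]] r r_gt0 c.
set T := bigcup _ _ in thickT.
(* Outside [T] the value of [f] is a dummy 0. *)
have /choice[f fP] : forall n, exists t, T n -> F t /\ P (n * t).
  move=> n; have [[t Ft [_ Pt]]|nT] := pselect (T n); first by exists t.
  by exists 0.
have [M FM] : exists M, forall t, F t -> t < M.+1.
  have /finite_seqP[A ->] := finF; exists (\max_(u <- A) u) => t /= tA.
  by rewrite ltnS leq_bigmax_seq.
have [x [solx ntx Tx [[t k] kP]]] := partition_regular_finType (prT T thickT)
  (fun n => (inord (f n) : 'I_M.+1, c (n * f n))).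
(* Monochromaticity in the first component makes the multiplier the same for all entries, so one
   dilation moves [x] into [P]. *)
have ft i : f (x i) = t.
  by case: (kP i) => <- _; rewrite inordK // FM //; case: (fP _ (Tx i)).
have [i0] := nontrivial_index ntx.
have t_gt0 : 0 < t by rewrite -(ft i0); apply: F_pos; case: (fP _ (Tx i0)).
exists (fun i => t * x i); split.
- exact: solution_dilate.
- exact: nontrivial_dilate.
- by move=> i; rewrite mulnC -(ft i); case: (fP _ (Tx i)).
- by exists k => i; case: (kP i) => _ <-; rewrite mulnC ft.
Qed.

Lemma partition_regular_syndetic_solution :
  (forall S, mult_syndetic S -> has_nontrivial_solution_in Sys S) ->
  partition_regular_over Sys Npos.
Proof.
move=> solS r _ c.
have [d cd [k /solS[x [solx ntx dx]]]] := dilation_limit_syndetic c.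
have [t t_gt0 tP] := cd (\max_i x i).+1.
exists (fun i => t * x i); split.
- exact: solution_dilate.
- exact: nontrivial_dilate.
- by move=> i; apply: (solution_dilate t_gt0 solx).1.
- exists k => i; have [xi_gt0 <-] := dx i.
  by rewrite tP // xi_gt0 ltnS leq_bigmax.
Qed.

End PartitionRegularity.

Theorem theorem2p7 (s : nat) (Sys : seq {mpoly rat[s]})
    (Sys_dil : dilation_invariant Sys) :
  [<-> (* (I)   *) partition_regular_over Sys Npos;
       (* (II)  *) forall T : set nat, mult_thick T ->
                     partition_regular_over Sys T;
       (* (III) *) forall P : set nat, mult_pw_syndetic P ->
                     partition_regular_over Sys P;
       (* (IV)  *) forall S : set nat, mult_syndetic S ->
                     partition_regular_over Sys S;
       (* (V)   *) forall P : set nat, mult_pw_syndetic P ->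
                     has_nontrivial_solution_in Sys P;
       (* (VI)  *) forall S : set nat, mult_syndetic S ->
                     has_nontrivial_solution_in Sys S].
Proof.
tfae.
- exact: partition_regular_thick.
- exact: partition_regular_pw_syndetic.
- by move=> prP S /syndetic_pw_syndetic; apply: prP.
(* The step from (IV) to (V) passes through (I), (II) and (III), then uses a single colour. *)
- move=> prS P pwP; have prT := partition_regular_thick Sys_dil (prS _ syndetic_Npos).
  have prP := partition_regular_pw_syndetic Sys_dil prT pwP.
  have [x [solx ntx Px _]] := prP 1 isT (fun=> ord0).
  by exists x.
- by move=> solP S /syndetic_pw_syndetic; apply: solP.
- exact: partition_regular_syndetic_solution.
Qed.
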